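(* Let $X$ be a smooth projective variety over $\mathbb{C}$ of dimension $n$ and let $Y_\bullet : X=Y_0\supseteq Y_1\supseteq\dots\supseteq Y_{n-1}\supseteq Y_n=\{pt\}$ be an admissible flag such that $X$ admits a Minkowski base $D_1,\ldots,D_r$ with respect to $Y_\bullet$ whose corresponding Okounkov bodies $\Delta_{Y_\bullet}(D_i)$ are rational polyhedral. Then the global Okounkov body $\Delta_{Y_\bullet}(X)\subseteq\mathbb{R}^n\times N^1(X)_{\mathbb{R}}$ is rational polyhedral. More concretely, it is spanned, as a convex cone, by the set of vectors $$\bigcup_{i=1}^r\left\{(x,[D_i]) \;\middle|\; x \text{ a vertex of } \Delta_{Y_\bullet}(D_i)\right\}.$$
   Context: All varieties are over the complex numbers. An admissible flag on an $n$-dimensional variety $X$ is a chain $X=Y_0\supseteq Y_1\supseteq\dots\supseteq Y_n=\{pt\}$ of irreducible subvarieties with $\operatorname{codim}_X Y_i=i$, each smooth at the point $Y_n$. It defines a rank-$n$ valuation $\nu$ (with values in $\mathbb{Z}^n$, lexicographically ordered) on nonzero sections of line bundles, given by successive orders of vanishing along the $Y_i$. For a big divisor $D$, the Okounkov body $\Delta_{Y_\bullet}(D)\subseteq\mathbb{R}^n$ is the closed convex hull of $\bigcup_{m\ge1}\frac1m\{\nu(s): 0\ne s\in H^0(X,\mathcal{O}_X(mD))\}$. The global Okounkov body $\Delta_{Y_\bullet}(X)\subseteq\mathbb{R}^n\times N^1(X)_{\mathbb{R}}$ is the closed convex cone generated by all vectors $(\nu(s),[D])$ with $D$ an integral divisor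 and $0\neq s\in H^0(X,\mathcal{O}_X(D))$, where $[D]$ denotes the numerical class. For every big $D$ its fiber over $[D]$ under the second projection $pr_2$ satisfies $pr_2^{-1}([D])\cap\Delta_{Y_\bullet}(X)=\Delta_{Y_\bullet}(D)\times\{[D]\}$. For a pseudo-effective divisor $D$ that is not big, $\Delta_{Y_\bullet}(D)$ is defined by the same formula, i.e. as the fiber of $\Delta_{Y_\bullet}(X)$ over $[D]$. A finite collection $\{D_1,\dots,D_r\}$ of pseudo-effective divisors on $X$ is a Minkowski base with respect to $Y_\bullet$ if: (1) for any pseudo-effective divisor $D$ on $X$ there exist non-negative numbers $a_1,\dots,a_r$ such that $D=\sum a_iD_i$ (in $N^1(X)_{\mathbb{R}}$) and $\Delta_{Y_\bullet}(D)=\sum a_i\Delta_{Y_\bullet}(D_i)$ (Minkowski sum); and (2) each $\Delta_{Y_\bullet}(D_i)$ is indecomposable in the sense of Minkowski sums, i.e. whenever it is a Minkowski sum $K_1+K_2$ of convex bodies, each $K_j$ is a translate of a non-negative multiple of it. Bodies $\Delta_{Y_\bullet}(D_i)$ consisting of a single point are allowed. A convex body is rational polyhedral if it is the convex hull of finitely many rational points. A cone in $\mathbb{R}^n\times N^1(X)_{\mathbb{R}}$ is rational polyhedral if it is generated by finitely many vectors that are rational with respect to the lattice $\mathbb{Z}^n\times N^1(X)_{\mathbb{Z}}$, where $N^1(X)_{\mathbb{Z}}$ is the group of integral divisors modulo numerical equivalence. *)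

(* Defs.v *)
(* The field of complex numbers is R[i], where R : realType.

   A closed subvariety (irreducible, reduced) of the projective space of
   dimension N is represented by its homogeneous ideal, a homogeneous prime
   ideal of R[i][x_0, ..., x_N] that does not contain all the x_i.  Inclusions
   are therefore reversed: Z lies in X when X `<=` Z as ideals.  Such a prime P
   also serves as a (possibly non-closed) point at which to localise. *)
From HB Require Import structures.
From mathcomp Require Import all_boot all_order all_algebra.
From mathcomp Require Import all_classical all_reals all_analysis.
From mathcomp.real_closed Require Import complex.
(* the notations of mpoly are incompatible with those of analysis *)
From mathcomp.multinomials Require Import -(notations) mpoly.

Set Implicit Arguments.
Unset Strict Implicit.
Unset Printing Implicit Defensive.

Import Order.TTheory GRing.Theory Num.Theory.
Import numFieldNormedType.Exports.

Local Open Scope classical_set_scope.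
Local Open Scope ring_scope.

Notation polyring R N := (mpoly N.+1 R[i]).

Section Convexity.
Variables (R : realType).

Definition convex_cone (E : lmodType R) (K : set E) : Prop :=
  [/\ K 0,
      forall x y, K x -> K y -> K (x + y)
    & forall (a : R) x, 0 <= a -> K x -> K (a *: x)].

Definition cone_hull (E : lmodType R) (A : set E) : set E :=
  smallest (@convex_cone E) A.

Definition convex_hull (E : lmodType R) (A : set E) : set E :=
  smallest (@convex_set R E) A.

Definition dilate (E : lmodType R) (a : R) (K : set E) : set E :=
  [set a *: x | x in K].

Definition minkowski_sum (E : lmodType R) (r : nat) (K : 'I_r -> set E) :
    set E :=
  [set y | exists2 x : 'I_r -> E, forall i, K i (x i) & y = \sum_i x i].

Definition vertex (E : lmodType R) (K : set E) (x : E) : Prop :=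
  K x /\ forall (y z : E) (a : R), K y -> K z -> 0 < a < 1 ->
    x = a *: y + (1 - a) *: z -> y = x /\ z = x.

Variable n : nat.
Implicit Types K : set 'rV[R]_n.

Definition closed_convex_hull (A : set 'rV[R]_n) : set 'rV[R]_n :=
  smallest (fun K => convex_set K /\ closed K) A.

(* the interior is allowed to be empty *)
Definition convex_body K : Prop := [/\ K !=set0, compact K & convex_set K].

Definition translate_of_multiple K' K : Prop :=
  exists (a : R) (u : 'rV[R]_n), 0 <= a /\ K' = [set u + a *: x | x in K].

Definition indecomposable K : Prop :=
  forall K1 K2, convex_body K1 -> convex_body K2 ->
    K = [set x + y | x in K1 & y in K2] ->
    translate_of_multiple K1 K /\ translate_of_multiple K2 K.

Definition rational_polytope K : Prop :=
  exists (k : nat) (q : 'I_k -> 'rV[rat]_n),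
    K = convex_hull (range (fun i => map_mx (@ratr R) (q i))).

End Convexity.

Section ProjectiveVarieties.
Variables (R : realType) (N : nat).
Local Notation S := (polyring R N).
Implicit Types (J P X Z C x : set S) (f g t : S).

Definition homog_of_deg (d : nat) f : Prop := f \is ishomog1 d mdeg.

Definition is_form f : Prop := exists d, homog_of_deg d f.

Definition subvariety P : Prop :=
  [/\ idealr_closed (mem P), prime_idealr_closed (mem P),
      forall f d, P f -> P (pihomog mdeg d f)
    & exists i, ~ P (mpolyX R[i] (mnm1 i))].

Definition lies_in Z X : Prop := subvariety Z /\ X `<=` Z.

Definition chain X Z (k : nat) : Prop :=
  exists p : nat -> set S,
    [/\ p 0%N = X, p k = Z,
        forall i, (i <= k)%N -> subvariety (p i)
      & forall i, (i < k)%N -> p i `<` p i.+1].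

Definition dimension X (d : nat) : Prop :=
  (exists Z, chain X Z d) /\ forall Z k, chain X Z k -> (k <= d)%N.

Definition codimension X Z (c : nat) : Prop :=
  chain X Z c /\ forall k, chain X Z k -> (k <= c)%N.

Definition closed_point X x : Prop := lies_in x X /\ dimension x 0.

(* Germs at P are handled through forms: a form of degree d gives a germ after
   division by any form of degree d outside P, and two choices differ by a
   unit.  [local_ideal P J] consists of the f whose germ at P lies in the ideal
   generated by J. *)
Definition local_ideal P J : set S :=
  [set f | exists h, [/\ is_form h, ~ P h & J (h * f)]].

Definition adjoin J (k : nat) (t : 'I_k -> S) : set S :=
  [set f | exists a : 'I_k -> S, J (f - \sum_i a i * t i)].

Definition adjoin1 J t : set S := adjoin J (fun _ : 'I_1 => t).

(* the maximal ideal of the local ring of X at P, whose dimension is the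
   codimension c of P in X, is generated by c elements *)
Definition regular_at X P : Prop :=
  exists c (t : 'I_c -> S),
    [/\ codimension X P c, forall i, is_form (t i), forall i, P (t i)
      & P `<=` local_ideal P (adjoin X t)].

Definition smooth_projective_variety X (n : nat) : Prop :=
  [/\ subvariety X, dimension X n & forall P, lies_in P X -> regular_at X P].

(* near P, the subvariety Z of X is defined in X by the single equation t *)
Definition local_generator X Z P t : Prop :=
  [/\ is_form t, Z t & Z `<=` local_ideal P (adjoin1 X t)].

(* f = unit * t ^ k in the discrete valuation ring of X along Z *)
Definition form_ord X Z f (k : nat) : Prop :=
  exists t h u, [/\ local_generator X Z Z t, is_form h /\ ~ Z h,
    is_form u /\ ~ Z u & X (h * f - u * t ^+ k)].

(* a representative num / den of a nonzero rational function on X *)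
Record ratfun X := RatFun {
  num : S;
  den : S;
  num_den_homog : exists d, homog_of_deg d num /\ homog_of_deg d den;
  num_neq0 : ~ X num;
  den_neq0 : ~ X den }.

Definition rat_ord X Z (s : ratfun X) (k : int) : Prop :=
  exists i j : nat,
    [/\ form_ord X Z (num s) i, form_ord X Z (den s) j & k = i%:Z - j%:Z].

Definition prime_divisor X Z : Prop := lies_in Z X /\ codimension X Z 1.

(* Integral Weil divisors, as functions giving the multiplicity of each prime
   divisor; on smooth varieties they are the same as Cartier divisors. *)
Definition divisor X (D : set S -> int) : Prop :=
  finite_set [set Z | D Z != 0] /\ forall Z, D Z != 0 -> prime_divisor X Z.

(* s is a nonzero element of H^0(X, O_X(D)): div(s) + D >= 0 *)
Definition nonzero_section X (D : set S -> int) (s : ratfun X) : Prop :=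
  forall Z, prime_divisor X Z -> exists2 k, rat_ord Z s k & 0 <= k + D Z.

Definition linearly_equivalent X (D E : set S -> int) : Prop :=
  exists s : ratfun X,
    forall Z, prime_divisor X Z -> rat_ord Z s (D Z - E Z).

Definition local_equation X (D : set S -> int) P (e : ratfun X) : Prop :=
  forall Z, prime_divisor X Z -> Z `<=` P -> rat_ord Z e (D Z).

Definition free_mod J (k : nat) (F : 'I_k -> S) : Prop :=
  forall a : 'I_k -> R[i], J (\sum_i a i *: F i) -> forall i, a i = 0.

(* h^0(X, O_X(D)) >= k: any k sections can be put over a common denominator *)
Definition h0_ge X (D : set S -> int) (k : nat) : Prop :=
  exists s : 'I_k -> ratfun X,
    [/\ forall i, nonzero_section D (s i),
        forall i j, den (s i) = den (s j)
      & free_mod X (fun i => num (s i))].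

Definition big X (n : nat) (D : set S -> int) : Prop :=
  exists2 a : R, 0 < a & \forall m \near \oo,
    exists2 k, h0_ge X (D *+ m) k & a * m%:R ^+ n <= k%:R.

(* dim_C O_{C,x} / (f) *)
Definition local_length_ge C x f (k : nat) : Prop :=
  exists d (F : 'I_k -> S), (forall i, homog_of_deg d (F i)) /\
    free_mod (local_ideal x (adjoin1 C f)) F.

Definition local_length C x f (k : nat) : Prop :=
  local_length_ge C x f k /\ forall j, local_length_ge C x f j -> (j <= k)%N.

(* The order at x of the restriction to the curve C, not contained in the
   support of D, of a local equation of D. *)
Definition local_degree X (D : set S -> int) C x (k : int) : Prop :=
  exists (e : ratfun X) (i j : nat),
    [/\ local_equation D x e, ~ C (num e) /\ ~ C (den e),
        local_length C x (num e) i, local_length C x (den e) j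
      & k = i%:Z - j%:Z].

(* The intersection product with a curve C is characterised as the additive
   function of divisors, invariant under linear equivalence, that is the sum of
   the local degrees when C is not contained in the support of the divisor. *)
Definition is_intersection_with X C (deg : (set S -> int) -> int) : Prop :=
  [/\ forall D E, divisor X D -> divisor X E -> deg (D + E) = deg D + deg E,
      forall D E, divisor X D -> divisor X E ->
        linearly_equivalent X D E -> deg D = deg E
    & forall (D m : set S -> int), divisor X D ->
        (forall Z, D Z != 0 -> ~ (Z `<=` C)) ->
        (forall x, closed_point C x -> local_degree X D C x (m x)) ->
        deg D = \sum_(x \in [set x | closed_point C x]) m x].

Definition intersection X (D : set S -> int) C : int :=
  xget (fun _ => 0) [set deg | is_intersection_with X C deg] D.

Definition curve X : Type := {C : set S | lies_in C X /\ dimension C 1}.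

HB.instance Definition _ X := gen_eqMixin (curve X).
HB.instance Definition _ X := gen_choiceMixin (curve X).

(* N^1(X)_R is the linear span of the numerical classes in this space.  Being
   finite-dimensional, it is closed in it and inherits its usual topology from
   the pointwise one; so closures can be taken in the whole space. *)
Definition N1 X : Type := {ptws (curve X) -> R}.

HB.instance Definition _ X := Topological.on (N1 X).
HB.instance Definition _ X := GRing.Lmodule.copy (N1 X) (curve X -> R).

Definition num_class X (D : set S -> int) : N1 X :=
  fun C : curve X => (intersection X D (sval C))%:~R.
Arguments num_class : clear implicits.

Definition effective_classes X : set (N1 X) :=
  [set w | exists (D : set S -> int) (s : ratfun X),
    [/\ divisor X D, nonzero_section D s & w = num_class X D]].
Arguments effective_classes : clear implicits.

Definition pseudoeffective X (D : set S -> int) : Prop :=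
  divisor X D /\
  smallest (fun K : set (N1 X) => convex_cone K /\ closed K)
    (effective_classes X) (num_class X D).

End ProjectiveVarieties.

Arguments num_class {R N} X D _.
Arguments effective_classes {R N} X _.

Section OkounkovBodies.
Variables (R : realType) (N : nat).
Local Notation S := (polyring R N).
Variables (X : set S) (n : nat) (Y : nat -> set S).

Definition admissible_flag : Prop :=
  [/\ Y 0%N = X,
      forall i, (i < n)%N -> Y i `<=` Y i.+1,
      forall i, (i <= n)%N ->
        [/\ lies_in (Y i) X, codimension X (Y i) i & regular_at (Y i) (Y n)]
    & closed_point X (Y n)].

(* The i-th step: near the point Y n, the germ g i on Y i is
   (t i) ^ (v_i) * g i.+1 up to a unit, where t i is an equation of Y i.+1 in
   Y i and g i.+1 does not vanish identically on Y i.+1. *)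
Definition form_valuation (f : S) (v : 'rV[nat]_n) : Prop :=
  exists g t u : nat -> S, g 0%N = f /\ forall i : 'I_n,
    [/\ local_generator (Y i) (Y i.+1) (Y n) (t i),
        is_form (u i) /\ ~ Y n (u i),
        is_form (g i.+1) /\ ~ Y i.+1 (g i.+1)
      & Y i (u i * g i - t i ^+ v 0 i * g i.+1)].

(* A section s of O_X(D) is the germ s * e = f / w, e being an equation of D at
   the point Y n. *)
Definition valuation (D : set S -> int) (s : ratfun X) (v : 'rV[nat]_n) :
    Prop :=
  exists (e : ratfun X) (f w : S),
    [/\ local_equation D (Y n) e, is_form f, is_form w /\ ~ Y n w,
        X (num s * num e * w - den s * den e * f)
      & form_valuation f v].

Definition real_vec (v : 'rV[nat]_n) : 'rV[R]_n := map_mx (fun k => k%:R) v.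

Definition global_okounkov_body : set ('rV[R]_n * N1 X) :=
  smallest (fun K : set ('rV[R]_n * N1 X) => convex_cone K /\ closed K)
    [set w | exists (D : set S -> int) (s : ratfun X) (v : 'rV[nat]_n),
      [/\ divisor X D, nonzero_section D s, valuation D s v
        & w = (real_vec v, num_class X D)]].

Definition normalized_valuations (D : set S -> int) : set 'rV[R]_n :=
  [set x | exists (m : nat) (s : ratfun X) (v : 'rV[nat]_n),
    [/\ (0 < m)%N, nonzero_section (D *+ m) s, valuation (D *+ m) s v
      & x = m%:R^-1 *: real_vec v]].

Definition okounkov_body (D : set S -> int) : set 'rV[R]_n :=
  if `[< big X n D >] then closed_convex_hull (normalized_valuations D)
  else [set x | global_okounkov_body (x, num_class X D)].

Definition minkowski_base (r : nat) (D : 'I_r -> set S -> int) : Prop :=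
  [/\ forall i, pseudoeffective X (D i),
      forall E, pseudoeffective X E -> exists a : 'I_r -> R,
        [/\ forall i, 0 <= a i,
            num_class X E = \sum_i a i *: num_class X (D i)
          & okounkov_body E =
            minkowski_sum (fun i => dilate (a i) (okounkov_body (D i)))]
    & forall i, indecomposable (okounkov_body (D i))].

(* some positive multiple lies in Z^n x N^1(X)_Z *)
Definition rational_vector (w : 'rV[R]_n * N1 X) : Prop :=
  exists (m : nat) (z : 'rV[int]_n) (D : set S -> int),
    [/\ (0 < m)%N, divisor X D
      & m%:R *: w = (map_mx (fun k : int => k%:~R) z, num_class X D)].

Definition rational_polyhedral_cone (K : set ('rV[R]_n * N1 X)) : Prop :=
  exists (k : nat) (w : 'I_k -> 'rV[R]_n * N1 X),
    (forall i, rational_vector (w i)) /\ K = cone_hull (range w).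

End OkounkovBodies.

Arguments global_okounkov_body {R N} X n Y _.
Arguments okounkov_body {R N} X n Y D _.

(* Main.v *)
Require Import Defs.
From mathcomp Require Import all_boot all_order all_algebra.
From mathcomp Require Import all_classical all_reals all_analysis.
From mathcomp.real_closed Require Import complex.
From mathcomp.multinomials Require Import -(notations) mpoly.
From mathcomp Require Import ring lra.

Set Implicit Arguments.
Unset Strict Implicit.
Unset Printing Implicit Defensive.

Import Order.TTheory GRing.Theory Num.Theory.
Import numFieldNormedType.Exports.

Local Open Scope classical_set_scope.
Local Open Scope ring_scope.

(** Let G be the global Okounkov body.  Write each rational polytope Delta(D_i)
    as the convex hull of finitely many rational points q_ij, let C' be the cone
    generated by the finitely many vectors (q_ij, [D_i]), and let C be the cone
    generated by the (x, [D_i]) with x a vertex of Delta(D_i).  The theorem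
    follows from the cycle of inclusions of G in C', of C' in C and of C in G.

    G in C'.  Let v be the valuation of a nonzero section of O_X(E).  Then v
    lies in Delta(E) ([okounkov_body_valuation]) and E is pseudo-effective, so
    the Minkowski base gives [E] = sum a_i [D_i] and v = sum a_i x_i with
    a_i >= 0 and x_i in Delta(D_i).  Hence (v, [E]) = sum a_i (x_i, [D_i]) is
    in C'.  As G is the smallest closed convex cone containing all the (v, [E]),
    it remains to see that C' is closed.  It is, being finitely generated
    ([closed_cone_hull]); but N^1(X)_R sits in a possibly infinite product of
    lines, so this is deduced from an algebraic form of the Farkas lemma
    ([farkas]), applied to the continuous linear functionals.

    C' in C.  A polytope is the convex hull of its vertices
    ([polytope_hull_vertices]).

    C in G.  Delta(D_i) lies in the fibre of G over [D_i]
    ([okounkov_body_sub_fiber]).  When D_i is not big this is the definition of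
    Delta(D_i).  When it is big, the fibre is closed and convex and contains the
    normalized valuations, because [m D_i] = m [D_i].

    The cone C' is rational, each q_ij having a common denominator m, for which
    m (q_ij, [D_i]) is the integral vector (m q_ij, [m D_i]). *)

(** * Convex hulls, cones and vertices *)

Section Hulls.
Context {R : realType} {E : lmodType R}.
Implicit Types (A H K : set E) (x y h : E) (s : seq E).

Lemma convex_setP A :
  convex_set A <-> forall x y (t : R), 0 <= t <= 1 -> A x -> A y ->
    A (t *: x + (1 - t) *: y).
Proof.
split=> [cA x y t /andP[t0 t1] Ax Ay | cA x y t].
  have := cA x y (Itv01 t0 t1).
  by rewrite !inE => /(_ Ax Ay).
rewrite !inE => Ax Ay; apply: cA => //.
by rewrite ge0 le1.
Qed.

Lemma convex_barycenter A (a b : R) x y : convex_set A -> A x -> A y ->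
  0 <= a -> 0 <= b -> 0 < a + b ->
  A ((a + b)^-1 *: (a *: x + b *: y)).
Proof.
move=> /convex_setP cA Ax Ay a0 b0 ab0.
have -> : (a + b)^-1 *: (a *: x + b *: y)
    = (a / (a + b)) *: x + (1 - a / (a + b)) *: y.
  rewrite scalerDr !scalerA; congr (_ *: _ + _ *: _); field; exact: lt0r_neq0.
apply: cA => //; rewrite divr_ge0 ?(ltW ab0)//=.
by rewrite ler_pdivrMr // mul1r lerDl.
Qed.

Lemma convex_hull_convex A : convex_set (convex_hull A).
Proof.
apply/convex_setP => x y t t01 Ax Ay B [cB AB].
by move/convex_setP: (cB); apply=> //; [apply: Ax | apply: Ay].
Qed.

Lemma cone_hull_cone A : convex_cone (cone_hull A).
Proof.
split=> [B [[]]//|x y Ax Ay B [cB AB]|a x a0 Ax B [cB AB]]; case: (cB) => _ D Z.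
  by apply: D; [apply: Ax | apply: Ay].
by apply: Z => //; apply: Ax.
Qed.

Lemma convex_cone_sum K (I : finType) (x : I -> E) :
  convex_cone K -> (forall i, K (x i)) -> K (\sum_i x i).
Proof. by case=> K0 KD _ Kx; elim/big_ind: _ => //. Qed.

(** The union of the segments from x to the points of a convex set is already
    convex.  H has to be nonempty for x itself to lie on such a segment. *)
Lemma convex_hull_add_point H h x : convex_set H -> H h ->
  convex_hull (x |` H) `<=` [set y | exists (a : R) (z : E),
    [/\ 0 <= a <= 1, H z & y = a *: x + (1 - a) *: z]].
Proof.
move=> cH Hh.
apply: smallest_sub => [|y []].
- apply/convex_setP => y1 y2 t /andP[t0 t1].
  move=> [a [y [/andP[a0 a1] Hy ->]]] [b [z [/andP[b0 b1] Hz ->]]].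
  (* c and d are the weights that y and z receive in the combination *)
  set c := t * (1 - a); set d := (1 - t) * (1 - b).
  have c0 : 0 <= c by rewrite mulr_ge0 ?subr_ge0.
  have d0 : 0 <= d by rewrite mulr_ge0 ?subr_ge0.
  have ta : 0 <= t * a by rewrite mulr_ge0.
  have tb : 0 <= (1 - t) * b by rewrite mulr_ge0 ?subr_ge0.
  have E1 : t * a + (1 - t) * b = 1 - (c + d) by rewrite /c /d; ring.
  have r01 : 0 <= 1 - (c + d) <= 1 by rewrite -E1; apply/andP; split; lra.
  have -> : t *: (a *: x + (1 - a) *: y) + (1 - t) *: (b *: x + (1 - b) *: z)
     = (1 - (c + d)) *: x + (c *: y + d *: z).
    by rewrite -E1 !scalerDr !scalerA addrACA -scalerDl.
  have [cd0|/eqP cd0] := eqVneq (c + d) 0.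
    exists 1, h; split; rewrite ?lexx ?ler01 //.
    have [-> ->] : c = 0 /\ d = 0 by split; lra.
    by rewrite !scale0r !addr0 !subr0 subrr scale0r addr0.
  exists (1 - (c + d)), ((c + d)^-1 *: (c *: y + d *: z)); split => //.
    by apply: convex_barycenter => //; rewrite lt_neqAle addr_ge0 // andbT eq_sym; apply/eqP.
  by rewrite subKr scalerA divff ?scale1r //; apply/eqP.
- by move=> /= ->; exists 1, h; split; rewrite ?lexx ?ler01 // subrr scale0r scale1r addr0.
- by move=> Hy; exists 0, y; split; rewrite ?lexx ?ler01 // subr0 scale0r scale1r add0r.
Qed.

Lemma convex_hull_mono A H : A `<=` H -> convex_hull A `<=` convex_hull H.
Proof. by apply: sub_smallest2r; apply: convex_hull_convex. Qed.

(** Suppose x lies strictly between y and z, and write y and z as combinations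
    of x with points y' and z' of H.  If y' or z' occurs with a nonzero weight,
    solving for x makes x a barycenter of y' and z', so a point of H. *)
Lemma vertex_added_point H x : convex_set H -> ~ H x ->
  vertex (convex_hull (x |` H)) x.
Proof.
move=> cH nHx; split; first by apply: sub_gen_smallest; left.
have [[h Hh]|H0] := pselect (exists h, H h); last first.
  have single : convex_hull (x |` H) `<=` [set x].
    apply: smallest_sub => [|y [//|Hy]].
      by apply/convex_setP => y1 y2 t _ /= -> ->; rewrite -scalerDl addrC subrK scale1r.
    by case: H0; exists y.
  by move=> y z t /single -> /single ->.
move=> y z t /(convex_hull_add_point cH Hh)[a [y' [/andP[a0 a1] Hy ->]]].
move=> /(convex_hull_add_point cH Hh)[b [z' [/andP[b0 b1] Hz ->]]].
move=> /andP[t0 t1] xE.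
set c := t * (1 - a); set d := (1 - t) * (1 - b).
have c0 : 0 <= c by rewrite mulr_ge0 ?subr_ge0 // ltW.
have d0 : 0 <= d by rewrite mulr_ge0 ?subr_ge0 // ltW.
have cdx : (c + d) *: x = c *: y' + d *: z'.
  have E1 : c + d = 1 - (t * a + (1 - t) * b) by rewrite /c /d; ring.
  rewrite E1 scalerBl scale1r {1}xE !scalerDr !scalerA addrACA -scalerDl.
  by rewrite addrAC subrr add0r.
have [cd0|cd0] := eqVneq (c + d) 0; last first.
  case: nHx; have -> : x = (c + d)^-1 *: (c *: y' + d *: z').
    by rewrite -cdx scalerA mulVf ?scale1r.
  by apply: convex_barycenter => //; rewrite lt_neqAle eq_sym cd0 addr_ge0.
have /eqP : c = 0 by lra.
have /eqP : d = 0 by lra.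
rewrite !mulf_eq0 (gt_eqF t0) !subr_eq0 (gt_eqF t1) /= => /eqP <- /eqP <-.
by rewrite subrr !scale0r !scale1r !addr0.
Qed.

(** In a finite family from which no point can be removed without shrinking the
    convex hull, every point is a vertex of the hull, by
    [vertex_added_point]. *)
Lemma polytope_hull_vertices s :
  convex_hull [set` s] `<=` convex_hull (vertex (convex_hull [set` s])).
Proof.
have [k] := ubnP (size s); elim: k s => // k IH s /ltnSE sk.
have [[x xs xH]|irr] := pselect (exists2 x, x \in s & convex_hull [set` rem x s] x).
  have <- : convex_hull [set` rem x s] = convex_hull [set` s].
    apply/seteqP; split.
      by apply: convex_hull_mono => y /= /mem_rem.
    apply: smallest_sub; first exact: convex_hull_convex.
    move=> y /= ys; have [->//|yx] := eqVneq y x.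
    apply: sub_gen_smallest => /=; move: ys.
    by rewrite (perm_mem (perm_to_rem xs)) inE (negPf yx).
  by apply: IH; rewrite size_rem //; case: (s) xs sk.
apply: convex_hull_mono => x /= xs.
have nH : ~ convex_hull [set` rem x s] x by move=> xH; apply: irr; exists x.
have := vertex_added_point (@convex_hull_convex _) nH.
congr (vertex _ x); apply/seteqP; split.
  apply: smallest_sub; first exact: convex_hull_convex.
  move=> y [-> /=|]; first exact: sub_gen_smallest.
  by apply: convex_hull_mono => z /= /mem_rem.
apply: convex_hull_mono => y /=; rewrite (perm_mem (perm_to_rem xs)) inE.
by move=> /predU1P[->|yr]; [left | right; apply: sub_gen_smallest].
Qed.

(** ** Finitely generated cones as intersections of half-spaces *)

Section Farkas.
(** No topology is assumed on E: Phi stands for a space of linear functionals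
    that is large enough to separate points. *)
Variable Phi : set (E -> R).
Hypothesis Phi_linear : forall f, Phi f -> scalar f.
Hypothesis Phi_comb : forall f g (c : R), Phi f -> Phi g ->
  Phi (fun x => f x - c * g x).
Hypothesis Phi_separating : forall x, x != 0 -> exists2 f, Phi f & f x != 0.

(** Induction on the number of generators.  To add a generator v, separate b from
    the cone of the others by f.  If f v >= 0, then f still works.  Otherwise let
    p be the projection onto ker f along v.  It moves the other generators by
    nonnegative multiples of v, and b by a negative one, so p b is not in the
    cone of their images; a functional g separating them gives g \o p, which
    vanishes at v and which Phi contains, because it is g - (g v / f v) f. *)
Lemma farkas s b : ~ cone_hull [set` s] b ->
  exists f, [/\ Phi f, forall x, x \in s -> 0 <= f x & f b < 0].
Proof.
have linE f : Phi f -> forall c x y, f (c *: x + y) = c * f x + f y.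
  by move=> /Phi_linear lf c x y; rewrite lf.
have [k] := ubnP (size s); elim: k s b => // k IH [|v s] b /ltnSE /= sk nb.
  have b0 : b != 0.
    by apply/eqP => b0; apply: nb; rewrite b0; case: (cone_hull_cone [set` [::]]).
  have [f Pf fb] := Phi_separating b0.
  have [fb0|fb0] := ltP (f b) 0; first by exists f.
  (* this functional is - f *)
  exists (fun x => f x - 2 * f x); split=> //; first exact: Phi_comb.
  by move: fb; rewrite neq_lt => /orP[] ?; lra.
have [_ coneD coneZ] := cone_hull_cone [set` v :: s].
have coneS : cone_hull [set` s] `<=` cone_hull [set` v :: s].
  apply: sub_smallest2r; first exact: cone_hull_cone.
  by move=> x /= xs; rewrite inE xs orbT.
have conev : cone_hull [set` v :: s] v.
  by apply: sub_gen_smallest => /=; rewrite inE eqxx.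
have [f [Pf fs fb]] := IH s b sk (contra_not (coneS b) nb).
have [fv|fv] := leP 0 (f v).
  by exists f; split=> // x; rewrite inE => /predU1P[->//|]; apply: fs.
pose p x := (- (f x / f v)) *: v + x.
have fv0 := ltr0_neq0 fv.
have npb : ~ cone_hull [set` map p s] (p b).
  move=> cpb; apply: nb.
  have -> : b = (f b / f v) *: v + p b by rewrite /p scaleNr addNKr.
  apply: (coneD); first by apply: (coneZ) => //; rewrite -mulrNN -invrN divr_ge0 ?oppr_ge0 ?ltW.
  have: cone_hull [set` map p s] `<=` cone_hull [set` v :: s]; last exact.
  apply: smallest_sub; first exact: cone_hull_cone.
  move=> _ /= /mapP[x xs ->]; apply: (coneD).
    by apply: (coneZ) => //; rewrite -mulrN -invrN divr_ge0 ?fs // oppr_ge0 ltW.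
  by apply: sub_gen_smallest => /=; rewrite inE xs orbT.
have sk' : (size (map p s) < k)%N by rewrite size_map.
have [g [Pg gs gb]] := IH _ _ sk' npb.
have gpE x : g (p x) = g x - (g v / f v) * f x.
  by rewrite /p linE //; field.
exists (fun x => g x - (g v / f v) * f x); split.
- exact: Phi_comb.
- move=> x; rewrite inE => /predU1P[->|xs]; first by rewrite divfK ?subrr.
  by rewrite -gpE; apply: gs; apply: map_f.
- by rewrite -gpE.
Qed.

Lemma cone_hull_halfspaces s : cone_hull [set` s] =
  \bigcap_(f in [set f | Phi f /\ forall x, x \in s -> 0 <= f x])
    [set x | 0 <= f x].
Proof.
apply/seteqP; split.
  apply: smallest_sub => [|x /= xs f [_]]; last exact.
  split=> [f|x y xP yP f|a x a0 xP f] [Pf fs] /=; have lf := Phi_linear Pf;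
    have f0 : f 0 = 0 by have := lf (-1) 0 0; rewrite scaler0 addr0 mulN1r addNr.
  - by rewrite f0.
  - by have := lf 1 x y; rewrite scale1r mul1r => ->; exact: addr_ge0 (xP f (conj Pf fs)) (yP f (conj Pf fs)).
  - by have := lf a x 0; rewrite addr0 f0 addr0 => ->; exact: mulr_ge0 a0 (xP f (conj Pf fs)).
move=> b bP; apply: contrapT => /farkas [f [Pf fs]].
by rewrite ltNge bP.
Qed.

End Farkas.
End Hulls.

(** * Closed cones in the space of the global Okounkov body *)

Lemma convex_cone_fiber (R : realType) (E F : lmodType R) (K : set (E * F)) c :
  convex_cone K -> convex_set [set x | K (x, c)].
Proof.
move=> [_ KD KZ]; apply/convex_setP => x y t /andP[t0 t1] Kx Ky /=.
have -> : (t *: x + (1 - t) *: y, c) = t *: (x, c) + (1 - t) *: (y, c).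
  by congr (_, _); rewrite /= -scalerDl addrC subrK scale1r.
by apply: KD; apply: KZ; rewrite ?subr_ge0.
Qed.

Lemma continuous_sub_scale (R : realType) (T : topologicalType) (f g : T -> R)
    (c : R) :
  continuous f -> continuous g -> continuous (fun x => f x - c * g x).
Proof.
move=> cf cg x; apply: cvgB; first exact: cf.
by apply: cvgM; [exact: cvg_cst | exact: cg].
Qed.

Section ClosedCones.
Context {R : realType} {N n : nat} {X : set (polyring R N)}.
Local Notation V := ('rV[R]_n * N1 X)%type.

(** The coordinates of both factors are continuous functionals and separate
    points. *)
Lemma closed_cone_hull (s : seq V) : closed (cone_hull [set` s]).
Proof.
pose Phi := [set f : V -> R | scalar f /\ continuous f].
rewrite (@cone_hull_halfspaces _ _ Phi).
- apply: closed_bigI => f [[_ cf] _].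
  by move/continuous_closedP: cf => /(_ _ (@closed_ge R 0)).
- by move=> f [].
- move=> f g c [lf cf] [lg cg]; split.
    by move=> a x y; rewrite lf lg /=; ring.
  exact: continuous_sub_scale.
- move=> [x w] xw0; apply: contrapT => noPhi.
  have zero f : Phi f -> f (x, w) = 0.
    by move=> Pf; apply: contrapT => /eqP fxw; apply: noPhi; exists f.
  move/eqP: xw0; apply; congr (_, _).
    apply/rowP => j; rewrite mxE; apply: (zero (fun v => v.1 0 j)); split.
      by move=> a u v /=; rewrite !mxE.
    move=> v; apply: (@continuous_comp _ _ _ fst (fun u : 'rV[R]_n => u 0 j)).
      exact: cvg_fst.
    exact: coord_continuous.
  apply/funext => C; apply: (zero (fun v => v.2 C)); split; first by [].
  move=> v; apply: (@continuous_comp _ _ _ snd (fun u : N1 X => u C)).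
    exact: cvg_snd.
  exact: (@proj_continuous _ (fun=> R)).
Qed.

Lemma closed_fiber (K : set V) c : closed K -> closed [set x | K (x, c)].
Proof.
suff /continuous_closedP ci : continuous (fun x : 'rV[R]_n => (x, c) : V) by apply: ci.
move=> x; apply: (cvg_pair (FF := nbhs_filter x) (FG := nbhs_filter x)
  (FH := nbhs_filter c) (f := idfun) (g := cst c)); last exact: cst_continuous.
by move=> A.
Qed.

Lemma global_okounkov_body_cone Y : convex_cone (global_okounkov_body X n Y).
Proof.
split=> [B [[[]]]//|x y Ax Ay B [[cB BK] AB]|a x a0 Ax B [[cB BK] AB]].
  by case: (cB) => _ D _; apply: D; [apply: Ax | apply: Ay].
by case: (cB) => _ _ Z; apply: Z => //; apply: Ax.
Qed.

Lemma global_okounkov_body_closed Y : closed (global_okounkov_body X n Y).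
Proof. by apply: closed_bigI => B [[]]. Qed.

End ClosedCones.

(** * Numerical classes *)

Section Divisors.
Context {R : realType} {N : nat} {X : set (polyring R N)}.
Implicit Types D E : set (polyring R N) -> int.

Lemma divisor0 : divisor X 0.
Proof.
split=> [|Z]; last by rewrite eqxx.
by apply: (sub_finite_set (B := set0)) => // Z /=; rewrite eqxx.
Qed.

Lemma divisorD D E : divisor X D -> divisor X E -> divisor X (D + E).
Proof.
move=> [Dfin DX] [Efin EX].
have supp Z : (D + E) Z != 0 -> D Z != 0 \/ E Z != 0.
  move=> DE0; have [D0|] := eqVneq (D Z) 0; last by left.
  by right; move: DE0; rewrite addrfctE D0 add0r.
split; last by move=> Z /supp [/DX|/EX].
apply: (sub_finite_set (B := [set Z | D Z != 0] `|` [set Z | E Z != 0])).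
  by move=> Z /supp.
by rewrite finite_setU.
Qed.

Lemma divisorMn D m : divisor X D -> divisor X (D *+ m).
Proof.
by move=> DX; elim: m => [|m IH]; [exact: divisor0 | rewrite mulrS; apply: divisorD].
Qed.

(** Either some additive intersection function with the curve exists, and the
    chosen one is additive, or the intersection number is zero by default. *)
Lemma num_classD D E : divisor X D -> divisor X E ->
  num_class X (D + E) = num_class X D + num_class X E.
Proof.
move=> DX EX; apply/funext => C.
rewrite -[RHS]/(num_class X D C + num_class X E C) /num_class -intrD.
congr (_%:~R); rewrite /intersection; set P := [set deg | _].
have [[deg degP]|P0] := pselect (exists deg, P deg).
  by have [+ _ _] := xgetPex (fun=> 0) (ex_intro _ deg degP); apply.
by rewrite xgetPN // => deg degP; apply: P0; exists deg.
Qed.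

Lemma num_classMn D m : divisor X D ->
  num_class X (D *+ m) = m%:R *: num_class X D.
Proof.
move=> DX; elim: m => [|m IH]; last first.
  by rewrite mulrS num_classD ?IH ?mulrS ?scalerDl ?scale1r //; apply: divisorMn.
(* the class of 0 is twice itself *)
have := num_classD divisor0 divisor0.
rewrite addr0 scale0r mulr0n => /esym/eqP.
by rewrite -subr_eq0 addrK => /eqP.
Qed.

End Divisors.

(** * Rational points *)

Lemma common_denominator n (q : 'rV[rat]_n) : exists (m : nat) (z : 'rV[int]_n),
  (0 < m)%N /\ m%:R *: q = map_mx intr z.
Proof.
exists (\prod_j `|denq (q 0%R j)|)%N.
exists (\row_j (numq (q 0 j) * (\prod_(l | l != j) `|denq (q 0%R l)|)%N%:Z)).
split; first by rewrite prodn_gt0 // => j; rewrite absz_gt0 denq_neq0.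
apply/rowP => j; rewrite !mxE (bigD1 j) //= natrM intrM numqE pmulrn.
rewrite absz_denq -pmulrn; ring.
Qed.

(** * Okounkov bodies and the global body *)

Section OkounkovFibers.
Context {R : realType} {N n : nat} {X : set (polyring R N)}.
Context {Y : nat -> set (polyring R N)}.
Implicit Types D : set (polyring R N) -> int.

Lemma okounkov_body_sub_fiber D : divisor X D ->
  okounkov_body X n Y D `<=`
    [set x | global_okounkov_body X n Y (x, num_class X D)].
Proof.
move=> DX; rewrite /okounkov_body; case: asboolP => _; last by [].
apply: smallest_sub => [|x [m [s [v [m0 sD vD ->]]]] /=].
  split; first exact/convex_cone_fiber/global_okounkov_body_cone.
  by apply: closed_fiber; apply: global_okounkov_body_closed.
have -> : (m%:R^-1 *: real_vec R v, num_class X D) =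
    m%:R^-1 *: (real_vec R v, num_class X (D *+ m)).
  rewrite num_classMn //; congr (_, _).
  by rewrite /= scalerA mulVf ?scale1r // pnatr_eq0 -lt0n.
have [_ _ Z] := @global_okounkov_body_cone _ _ n X Y.
apply: (Z); first by rewrite invr_ge0.
apply: sub_gen_smallest; exists (D *+ m), s, v; split=> //.
exact: divisorMn.
Qed.

Lemma okounkov_body_valuation D (s : ratfun X) (v : 'rV[nat]_n) : divisor X D ->
  nonzero_section D s -> valuation Y D s v ->
  okounkov_body X n Y D (real_vec R v).
Proof.
move=> DX sD vD; rewrite /okounkov_body; case: asboolP => _.
  apply: sub_gen_smallest; exists 1%N, s, v.
  by rewrite mulr1n invr1 scale1r.
by apply: sub_gen_smallest; exists D, s, v.
Qed.

End OkounkovFibers.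

Lemma sum_pair (R : realType) (E F : lmodType R) (I : finType) (f : I -> E)
    (g : I -> F) :
  \sum_i (f i, g i) = (\sum_i f i, \sum_i g i).
Proof. by elim/big_rec3: _ => // i a b _ _ ->. Qed.

Lemma range_codom (I : finType) (T : eqType) (f : I -> T) :
  range f = [set` codom f].
Proof.
apply/seteqP; split=> [_ [i _ <-]|_ /codomP[i ->]] /=; first exact: codom_f.
by exists i.
Qed.

Theorem theorem1 (R : realType) (N n r : nat) (X : set (polyring R N))
    (Y : nat -> set (polyring R N))
    (D : 'I_r -> set (polyring R N) -> int)
    (X_smooth : smooth_projective_variety X n)
    (Y_admissible : admissible_flag X n Y)
    (D_base : minkowski_base X n Y D)
    (D_rational : forall i, rational_polytope (okounkov_body X n Y (D i))) :
  rational_polyhedral_cone (global_okounkov_body X n Y) /\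
  global_okounkov_body X n Y =
    cone_hull [set w | exists (i : 'I_r) (x : 'rV[R]_n),
      vertex (okounkov_body X n Y (D i)) x /\ w = (x, num_class X (D i))].
Proof.
have [Dpse Dsum _] := D_base.
have DX i : divisor X (D i) by case: (Dpse i).
set G := global_okounkov_body X n Y; set C := cone_hull [set w | _].
have [k kP] := choice D_rational.
pose q i := projT1 (cid (kP i)).
have bodyE i : okounkov_body X n Y (D i) =
    convex_hull (range (fun j => map_mx (@ratr R) (q i j))).
  exact: (projT2 (cid (kP i))).
pose w (t : {i : 'I_r & 'I_(k i)}) : 'rV[R]_n * N1 X :=
  (map_mx (@ratr R) (q (tag t) (tagged t)), num_class X (D (tag t))).
have coneC' := @cone_hull_cone _ _ (range w).
have GC' : G `<=` cone_hull (range w).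
  apply: smallest_sub => [|_ [E [s [v [EX sE vE ->]]]]].
    by split=> //; rewrite range_codom; apply: closed_cone_hull.
  have Epse : pseudoeffective X E.
    by split=> //; apply: sub_gen_smallest; exists E, s.
  have [a [a0 -> bodyDE]] := Dsum E Epse.
  have := okounkov_body_valuation EX sE vE; rewrite bodyDE => -[x xP ->].
  have /choice[z zP] i : exists z, okounkov_body X n Y (D i) z /\ a i *: z = x i.
    by have [z zi zx] := xP i; exists z.
  rewrite -sum_pair; apply: convex_cone_sum => // i.
  have [zi <-] := zP i.
  rewrite -[X in cone_hull _ X]/(a i *: (z i, num_class X (D i))).
  have [_ _ Z] := coneC'; apply: (Z) => //.
  move: zi; rewrite bodyE; move: (z i).
  apply: smallest_sub; first exact: convex_cone_fiber.
  move=> _ [j _ <-]; apply: sub_gen_smallest.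
  by exists (Tagged (fun i => 'I_(k i)) j).
have C'C : cone_hull (range w) `<=` C.
  apply: smallest_sub; first exact: cone_hull_cone.
  move=> _ [[i j] _ <-]; rewrite /w /=.
  have hullq : convex_hull (vertex (okounkov_body X n Y (D i)))
      (map_mx (@ratr R) (q i j)).
    rewrite bodyE range_codom; apply: polytope_hull_vertices.
    by apply: sub_gen_smallest; rewrite /= codom_f.
  move: hullq; move: (map_mx _ _); apply: smallest_sub.
    exact/convex_cone_fiber/cone_hull_cone.
  by move=> x xi; apply: sub_gen_smallest; exists i, x.
have CG : C `<=` G.
  apply: smallest_sub; first exact: global_okounkov_body_cone.
  by move=> _ [i [x [[xi _] ->]]]; apply: okounkov_body_sub_fiber.
split; last by apply/seteqP; split=> // x /GC' /C'C.
exists #|{: {i : 'I_r & 'I_(k i)}}|, (w \o enum_val); split=> [l|].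
  set t := enum_val l; rewrite /w /=.
  have [m [z [m0 mz]]] := common_denominator (q (tag t) (tagged t)).
  exists m, z, (D (tag t) *+ m); split=> //; first exact: divisorMn.
  congr (_, _); last by rewrite num_classMn.
  apply/rowP => j; rewrite !mxE.
  have /rowP/(_ j) := mz; rewrite !mxE => /(congr1 (@ratr R)).
  by rewrite rmorphM /= ratr_nat ratr_int.
have -> : range (w \o @enum_val _ {: {i : 'I_r & 'I_(k i)}}) = range w.
  apply/seteqP; split=> [_ [l _ <-]|_ [t _ <-]]; first by exists (enum_val l).
  by exists (enum_rank t) => //=; rewrite enum_rankK.
by apply/seteqP; split=> // x /C'C /CG.
Qed.
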